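(* For all $m\in\mathbb{N}$, $p(m,m)=\left\lceil \frac{2}{3}m\right\rceil$.
   Context: $\mathbb{N}=\{0,1,2,\ldots\}$. A lattice cell is a unit square $S(k,l)=[k-1,k]\times[l-1,l]$ with $k,l\in\mathbb{Z}$. A monotonically increasing polyomino is the union of a finite (nonempty) sequence of lattice cells $S_1,\ldots,S_q$ such that, for $j=1,\ldots,q-1$, if $S_j=S(k,l)$ then $S_{j+1}$ is either the right-hand neighbour $S(k+1,l)$ or the upper neighbour $S(k,l+1)$ of $S_j$; a monotonically decreasing polyomino is defined analogously, with the upper neighbour $S(k,l+1)$ replaced by the lower neighbour $S(k,l-1)$. A monotonous polyomino is one that is monotonically increasing or monotonically decreasing. For positive integers $m,n$ let $R_{m\times n}=[0,m]\times[0,n]$, and put $R_{m\times n}=\emptyset$ if $\min\{m,n\}=0$. Coverings of $R_{m\times n}$ are by monotonous polyominoes contained in $R_{m\times n}$; $R_{m\times n}$ is covered by them if it is equal to their union (the empty rectangle needs no polyominoes). For $m,n\in\mathbb{N}$, $p(m,n)=\min\{p\in\mathbb{N}: R_{m\times n}\text{ can be covered by } p\text{ monotonous polyominoes}\}$ (so $p(m,n)=0$ if $\min\{m,n\}=0$). *)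

(* Defs.v *)
From mathcomp Require Import all_boot all_order all_algebra.
From mathcomp Require Import boolp classical_sets set_interval reals.

Set Implicit Arguments.
Unset Strict Implicit.
Unset Printing Implicit Defensive.

Import Order.TTheory GRing.Theory Num.Theory.

Local Open Scope classical_set_scope.
Local Open Scope ring_scope.

(* The pair c = (k, l) stands for the unit square whose UPPER RIGHT corner is
   (k, l); the indices are arbitrary integers. *)
Definition cell (R : realType) (c : int * int) : set (R * R) :=
  `[c.1%:~R - 1, c.1%:~R] `*` `[c.2%:~R - 1, c.2%:~R].
Arguments cell : clear implicits.

Definition right_neighbour (c : int * int) : int * int := (c.1 + 1, c.2).
Definition upper_neighbour (c : int * int) : int * int := (c.1, c.2 + 1).
Definition lower_neighbour (c : int * int) : int * int := (c.1, c.2 - 1).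

Definition incr_step : rel (int * int) :=
  fun c d => (d == right_neighbour c) || (d == upper_neighbour c).

Definition decr_step : rel (int * int) :=
  fun c d => (d == right_neighbour c) || (d == lower_neighbour c).

(* [sorted e s] only relates consecutive entries of s. *)
Definition incr_polyomino (R : realType) (P : set (R * R)) : Prop :=
  exists s : seq (int * int),
    [/\ s != [::], sorted incr_step s & P = \bigcup_(c in [set` s]) cell R c].

Definition decr_polyomino (R : realType) (P : set (R * R)) : Prop :=
  exists s : seq (int * int),
    [/\ s != [::], sorted decr_step s & P = \bigcup_(c in [set` s]) cell R c].

Definition monotonous_polyomino (R : realType) (P : set (R * R)) : Prop :=
  incr_polyomino P \/ decr_polyomino P.

(* Without the case distinction a rectangle with one zero side would be a
   segment or a point. *)
Definition rectangle (R : realType) (m n : nat) : set (R * R) :=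
  if minn m n == 0%N then set0 else `[0, m%:R] `*` `[0, n%:R].
Arguments rectangle : clear implicits.

(* The polyominoes of a covering may overlap, and are not required to be
   distinct. *)
Definition coverable (R : realType) (m n p : nat) : Prop :=
  exists F : 'I_p -> set (R * R),
    (forall i, monotonous_polyomino (F i) /\ F i `<=` rectangle R m n) /\
    rectangle R m n = \bigcup_i F i.

Lemma unit_interval_exists (R : realType) (m : nat) (x : R) :
  0 <= x <= m.+1%:R -> exists i : 'I_m.+1, i%:R <= x <= i.+1%:R.
Proof.
elim: m => [|m IHm] hx; first by exists ord0.
have /andP[x0 xm] := hx.
have [xle|xgt] := leP x m.+1%:R.
  have [|i hi] := IHm; first by rewrite x0.
  by exists (widen_ord (leqnSn _) i).
by exists ord_max; rewrite /= (ltW xgt).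
Qed.

Lemma coverable_exists (R : realType) (m n : nat) :
  exists p : nat, `[< coverable R m n p >].
Proof.
case: m => [|m].
  exists 0%N; apply/asboolP; exists (fun=> set0); split; first by case.
  by rewrite /rectangle min0n eqxx; apply/seteqP; split=> // x [[]].
case: n => [|n].
  exists 0%N; apply/asboolP; exists (fun=> set0); split; first by case.
  by rewrite /rectangle minn0 eqxx; apply/seteqP; split=> // x [[]].
pose I : finType := ('I_m.+1 * 'I_n.+1)%type.
pose sq (u : I) : set (R * R) := cell R (u.1.+1%:Z, u.2.+1%:Z).
have sqE u x : sq u x <->
    u.1%:R <= x.1 <= u.1.+1%:R /\ u.2%:R <= x.2 <= u.2.+1%:R.
  rewrite /sq /cell /= !in_itv /= -!pmulrn.
  have E (k : nat) : k.+1%:R - 1 = k%:R :> R by rewrite -natr1 addrK.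
  by rewrite !E.
have sub u : sq u `<=` rectangle R m.+1 n.+1.
  move=> x /sqE[/andP[a b] /andP[c d]].
  rewrite /rectangle minnSS /= !in_itv /=.
  split; apply/andP; split.
  - exact: le_trans a.
  - by apply: le_trans b _; rewrite ler_nat ltn_ord.
  - exact: le_trans c.
  - by apply: le_trans d _; rewrite ler_nat ltn_ord.
exists #|I|; apply/asboolP; exists (fun i => sq (enum_val i)); split.
  move=> i; split; last exact: sub.
  left; exists [:: ((enum_val i).1.+1%:Z, (enum_val i).2.+1%:Z)]; split=> //.
  apply/seteqP; split=> x.
    by exists ((enum_val i).1.+1%:Z, (enum_val i).2.+1%:Z) => //=; rewrite inE.
  by case=> c /=; rewrite inE => /eqP ->.
apply/seteqP; split=> x; last by case=> i _; exact: sub.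
rewrite /rectangle minnSS /= !in_itv /=.
case=> /unit_interval_exists[i hi] /unit_interval_exists[j hj].
by exists (enum_rank ((i, j) : I)) => //; rewrite enum_rankK; apply/sqE.
Qed.

Definition cover_number (R : realType) (m n : nat) : nat :=
  ex_minn (coverable_exists R m n).

(* Main.v *)
(* Lower bound.  Suppose k increasing and l decreasing polyominoes cover the
   m x m square, with k + l <= m.  At a lattice point let b be the length of
   the longest strictly increasing sequence of decreasingly covered cells to
   its lower left, and a the length of the longest strictly decreasing sequence
   of increasingly covered cells to its upper left; so b <= l and a <= k.
   Across a cell, a grows by alpha <= 1 along one diagonal and b by beta <= 1
   along the other, and alpha + beta >= 1 because the cell is covered.  The map
   (a, b) sends the cell to a quadrilateral of (discretised) area at most
   alpha + beta - 1.  Summed over the square, the areas give k l, since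
   (once a and b are capped below near the right-hand corners) the boundary is
   mapped onto that of [0, k] x [0, l], while alpha and beta
   telescope to at most k (2m - k) and l (2m - l).  Hence
   m^2 + k l <= k (2m - k) + l (2m - l), that is (m - k - l)^2 <= k l, which
   forces 2m <= 3 (k + l).

   Upper bound.  For m = 3k, the k increasing paths (1, r) -> (2k+1-r, r) ->
   (2k+1-r, 2k+r) -> (3k, 2k+r) and their images under a quarter turn cover the
   square; one more row and column cost one decreasing polyomino. *)

Require Import Defs.
From mathcomp Require Import all_boot all_order all_algebra.
From mathcomp Require Import boolp classical_sets set_interval reals.
From mathcomp Require Import zify ring lra.

Import Order.TTheory GRing.Theory Num.Theory.

Set Implicit Arguments.
Unset Strict Implicit.
Unset Printing Implicit Defensive.

Local Open Scope ring_scope.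

(** * Telescoping on a grid and the area inequality *)

Lemma sum_telescope (f : nat -> int) (n : nat) :
  \sum_(j < n) (f j.+1 - f j) = f n - f 0%N.
Proof. by rewrite -(big_mkord xpredT (fun j => f j.+1 - f j)) telescope_sumr. Qed.

(** A discrete Green formula: inner edges cancel and the four sides of the grid remain. *)
Lemma grid_telescope (m n : nat) (h v : nat -> nat -> int) :
  \sum_(i < m) \sum_(j < n) ((v i.+1 j - v i j) + (h i j.+1 - h i j)) =
  \sum_(j < n) (v m j - v 0%N j) + \sum_(i < m) (h i n - h i 0%N).
Proof.
transitivity (\sum_(i < m) (\sum_(j < n) (v i.+1 j - v i j) + (h i n - h i 0%N))).
  by apply: eq_bigr => i _; rewrite big_split /= (sum_telescope (h i)).
rewrite big_split /= exchange_big /=; congr (_ + _).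
by apply: eq_bigr => j _; rewrite (sum_telescope (v^~ j)).
Qed.

(* The sum on the left is a discrete version of the integral of a db along the
   right edge, hence the area enclosed by the image of the boundary. *)
Lemma area_bound (m n : nat) (a b : nat -> nat -> int) :
  (forall i j, (i < m)%N -> (j < n)%N ->
     [/\ a i j.+1 <= a i j, a i j.+1 <= a i.+1 j.+1,
         a i j <= a i.+1 j, a i.+1 j.+1 <= a i.+1 j
       & a i.+1 j <= a i j.+1 + 1]) ->
  (forall i j, (i < m)%N -> (j < n)%N ->
     [/\ b i j <= b i.+1 j, b i j <= b i j.+1,
         b i.+1 j <= b i.+1 j.+1, b i j.+1 <= b i.+1 j.+1
       & b i.+1 j.+1 <= b i j + 1]) ->
  (forall i j, (i < m)%N -> (j < n)%N ->
     1 <= (a i.+1 j - a i j.+1) + (b i.+1 j.+1 - b i j)) ->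
  (forall j, (j <= n)%N -> a 0%N j = 0) -> (forall i, (i <= m)%N -> a i n = 0) ->
  (forall j, (j <= n)%N -> b 0%N j = 0) -> (forall i, (i <= m)%N -> b i 0%N = 0) ->
  (m * n)%:Z + \sum_(j < n) a m j * (b m j.+1 - b m j) <=
    \sum_(j < n) (a m j + b m j.+1) + \sum_(i < m) (a i 0%N + b i n).
Proof.
move=> Ha Hb Hab al at_ bl bb.
(* Around a cell, the increments of [V] and [H] give the counterclockwise sum of a db, with [a] read
   at the lower or left end of each edge; those of [S] and [T] give alpha + beta. *)
pose V (i j : nat) : int := a i j * (b i j.+1 - b i j).
pose H (i j : nat) : int := - (a i j * (b i.+1 j - b i j)).
pose S (i j : nat) : int := a i j + b i j.+1.
pose T (i j : nat) : int := b i j - a i j.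
have EJ : \sum_(j < n) V m j =
    \sum_(i < m) \sum_(j < n) ((V i.+1 j - V i j) + (H i j.+1 - H i j)).
  rewrite grid_telescope [X in _ + X]big1 ?addr0; last first.
    move=> i _; have ltim := ltn_ord i.
    by rewrite /H at_ ?bb ?(ltnW ltim) // subrr mul0r mulr0 subrr.
  by apply: eq_bigr => j _; rewrite {3}/V al ?mul0r ?subr0 // ltnW.
have ES : \sum_(j < n) (a m j + b m j.+1) + \sum_(i < m) (a i 0%N + b i n) =
    \sum_(i < m) \sum_(j < n) ((S i.+1 j - S i j) + (T i j.+1 - T i j)).
  rewrite grid_telescope; congr (_ + _); apply: eq_bigr => i _; have lti := ltnW (ltn_ord i).
    by rewrite {2}/S al ?bl ?addr0 ?subr0.
  by rewrite /T at_ ?bb //; ring.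
have -> : (m * n)%:Z = \sum_(i < m) \sum_(j < n) 1 :> int.
  by rewrite !sumr_const !card_ord -mulrnA natz mulnC.
rewrite ES EJ -big_split /=; apply: ler_sum => i _.
rewrite -big_split /=; apply: ler_sum => j _.
have [] := Ha i j (ltn_ord i) (ltn_ord j).
have [] := Hb i j (ltn_ord i) (ltn_ord j).
have := Hab i j (ltn_ord i) (ltn_ord j).
rewrite /V /H /S /T.
move: (a i j) (a i.+1 j) (a i j.+1) (a i.+1 j.+1) => sw se nw ne.
move: (b i j) (b i.+1 j) (b i j.+1) (b i.+1 j.+1) => bsw bse bnw bne.
move=> h h1 h2 h3 h4 h5 h6 h7 h8 h9 h10.
(* If alpha = 0 or beta = 0, then [a] or [b] is constant on the cell and the area vanishes. If both
   are 1, a finite check bounds the area by 1. *)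
have [e|e] : se = nw \/ se = nw + 1 by lia.
- have -> : sw = nw by lia.
  rewrite e; nia.
- have [e'|e'] : bne = bsw \/ bne = bsw + 1 by lia.
  + have [-> ->] : bse = bsw /\ bnw = bsw by lia.
    rewrite e' e; lia.
  + have [->|->] : sw = nw \/ sw = nw + 1 by lia.
    all: have [->|->] : bse = bsw \/ bse = bsw + 1 by lia.
    all: have [->|->] : bnw = bsw \/ bnw = bsw + 1 by lia.
    all: rewrite e' e; nia.
Qed.

(** * Longest chains in a set of cells *)

Section LongestChain.

Variable C : nat -> nat -> bool.

(** Length of a longest chain, strictly increasing in both coordinates, among the cells (u, v) of
    [C] with u < i and v < j. The nested fixpoint allows recursion on either index. *)
Fixpoint lchain (i : nat) : nat -> nat :=
  if i is i'.+1 then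
    fix lchain_col (j : nat) : nat :=
      if j is j'.+1 then
        maxn (maxn (lchain i' j) (lchain_col j')) (lchain i' j' + C i' j')
      else 0%N
  else fun=> 0%N.

Lemma lchainS (i j : nat) :
  lchain i.+1 j.+1 =
  maxn (maxn (lchain i j.+1) (lchain i.+1 j)) (lchain i j + C i j).
Proof. by []. Qed.

Lemma lchain0 (i : nat) : lchain i 0 = 0%N. Proof. by case: i. Qed.

Lemma lchain_homoL (i j : nat) : (lchain i j <= lchain i.+1 j)%N.
Proof. by case: j => [|j]; rewrite ?lchain0 // lchainS; lia. Qed.

Lemma lchain_homoR (i j : nat) : (lchain i j <= lchain i j.+1)%N.
Proof. by case: i => [|i]; rewrite // lchainS; lia. Qed.

Lemma lchain_SL (i j : nat) : (lchain i.+1 j <= (lchain i j).+1)%N.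
Proof.
elim: j => [|j IH]; rewrite ?lchain0 // lchainS.
have := lchain_homoR i j; case: (C i j); lia.
Qed.

Lemma lchain_SR (i j : nat) : (lchain i j.+1 <= (lchain i j).+1)%N.
Proof.
elim: i => [|i IH]; rewrite // lchainS.
have := lchain_homoL i j; case: (C i j); lia.
Qed.

Lemma lchain_SS (i j : nat) : (lchain i.+1 j.+1 <= (lchain i j).+1)%N.
Proof.
rewrite lchainS; have := lchain_SL i j; have := lchain_SR i j.
case: (C i j); lia.
Qed.

Lemma lchain_leL (i j : nat) : (lchain i j <= i)%N.
Proof. by elim: i => // i IH; apply: leq_trans (lchain_SL i j) _. Qed.

Lemma lchain_leR (i j : nat) : (lchain i j <= j)%N.
Proof.
elim: j => [|j IH]; first by rewrite lchain0.
exact: leq_trans (lchain_SR i j) _.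
Qed.

(** No set [c t] contains two cells of a chain, so each cell of a chain uses up a new index. *)
Lemma lchain_le_card (I : finType) (c : I -> nat -> nat -> bool) :
  (forall i j, C i j -> exists t, c t i j) ->
  (forall t i j i' j', c t i j -> c t i' j' -> (i < i')%N -> (j < j')%N -> False) ->
  forall i j, (lchain i j <= #|I|)%N.
Proof.
move=> cov anti.
(* A chain through the cell (i, j) cannot have met the quadrant strictly before it. *)
pose met i j := [set t | [exists u : 'I_i, [exists v : 'I_j, c t u v]]].
have metP i j t :
    reflect (exists u v, [/\ u < i, v < j & c t u v]%N) (t \in met i j).
  rewrite inE; apply: (iffP existsP) => [[u /existsP[v h]]|[u [v [ui vj h]]]].
    by exists u, v.
  by exists (Ordinal ui); apply/existsP; exists (Ordinal vj).
have met_sub i j i' j' : (i <= i')%N -> (j <= j')%N -> met i j \subset met i' j'.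
  move=> ii jj; apply/fintype.subsetP => t /metP[u [v [ui vj h]]].
  by apply/metP; exists u, v; split => //; [apply: leq_trans ii|apply: leq_trans jj].
suff H i j : (lchain i j <= #|met i j|)%N.
  by move=> i j; apply: leq_trans (H i j) (max_card _).
elim: i j => [//|i IHi]; elim=> [//|j IHj].
rewrite lchainS !geq_max -andbA; apply/and3P; split.
- exact: leq_trans (IHi _) (subset_leq_card (met_sub _ _ _ _ _ _)).
- exact: leq_trans IHj (subset_leq_card (met_sub _ _ _ _ _ _)).
case Cij : (C i j); last first.
  by rewrite addn0 (leq_trans (IHi _)) // subset_leq_card // met_sub.
have [t ct] := cov _ _ Cij; rewrite addn1; apply: leq_ltn_trans (IHi j) _.
apply: proper_card; apply/fintype.properP; split; first exact: met_sub.
exists t; first by apply/metP; exists i, j.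
by apply/metP => -[u [v [ui vj h]]]; apply: anti h ct ui vj.
Qed.

End LongestChain.

(** * Chain lengths with prescribed values on one side *)

Section CappedChain.

Variables (C : nat -> nat -> bool) (m k : nat).

(* The cap [minn (k - (m - i)) j] (with truncated subtractions) pretends that
   the corner at (m, 0) is filled: it makes the values on the line [i = m]
   equal to [minn k j] without spoiling the local rules. *)
Definition cchain (i j : nat) : nat := maxn (lchain C i j) (minn (k - (m - i)) j).

Lemma cchain_homoL (i j : nat) : (cchain i j <= cchain i.+1 j)%N.
Proof. by have := lchain_homoL C i j; rewrite /cchain; lia. Qed.

Lemma cchain_homoR (i j : nat) : (cchain i j <= cchain i j.+1)%N.
Proof. by have := lchain_homoR C i j; rewrite /cchain; lia. Qed.

Lemma cchain_SS (i j : nat) : (i < m)%N -> (cchain i.+1 j.+1 <= (cchain i j).+1)%N.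
Proof. by have := lchain_SS C i j; rewrite /cchain; lia. Qed.

(** A positive cap grows by exactly 1 in a diagonal step with [i < m]; where the cap is 0, the chain
    itself grows. *)
Lemma cchain_lt (i j : nat) :
  (i < m)%N -> C i j -> (cchain i j < cchain i.+1 j.+1)%N.
Proof. by rewrite /cchain lchainS => im ->; lia. Qed.

Lemma cchain_le (i j : nat) :
  (k <= m)%N -> (lchain C i j <= k)%N -> (i <= m)%N -> (cchain i j <= minn k i)%N.
Proof. by have := lchain_leL C i j; rewrite /cchain; lia. Qed.

Lemma cchain_0R (i : nat) : cchain i 0 = 0%N.
Proof. by rewrite /cchain lchain0; lia. Qed.

Lemma cchain_last (j : nat) : (lchain C m j <= k)%N -> cchain m j = minn k j.
Proof. by have := lchain_leR C m j; rewrite /cchain; lia. Qed.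

End CappedChain.

(** * The quadratic inequality for coverings of a grid *)

Lemma sum_minn (m k : nat) : (k <= m)%N ->
  \sum_(j < m) (minn k j.+1)%:Z + \sum_(j < m) (minn k j)%:Z =
  k%:Z * (2 * m%:Z - k%:Z).
Proof.
move=> km; rewrite -big_split /=.
(* [f j] is the sum of the first [j] terms: j^2 as long as j <= k, then k (2j - k). *)
pose f j : int := (minn k j)%:Z * (2 * j%:Z - (minn k j)%:Z).
transitivity (\sum_(j < m) (f j.+1 - f j)).
  apply: eq_bigr => j _; rewrite /f.
  have [kj|jk] := leqP k j.
    have -> : minn k j.+1 = k by lia.
    lia.
  have -> : minn k j.+1 = j.+1 by lia.
  by rewrite -addn1 PoszD; ring.
by rewrite sum_telescope /f minn0 mul0r subr0; congr (_ * (_ - _)); lia.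
Qed.

(* Cells are indexed from 0 here. *)
Lemma grid_cover_area (m : nat) (I J : finType)
    (c : I -> nat -> nat -> bool) (d : J -> nat -> nat -> bool) :
  (forall t i j i' j',
     c t i j -> c t i' j' -> (i < i')%N -> (j' < j)%N -> False) ->
  (forall t i j i' j',
     d t i j -> d t i' j' -> (i < i')%N -> (j < j')%N -> False) ->
  (forall i j, (i < m)%N -> (j < m)%N ->
     (exists t, c t i j) \/ (exists t, d t i j)) ->
  (#|I| + #|J| <= m)%N ->
  (m%:Z - (#|I| + #|J|)%:Z) ^+ 2 <= #|I|%:Z * #|J|%:Z.
Proof.
move=> cP dP cov; set k := #|I|; set l := #|J| => klm.
have km : (k <= m)%N by lia.
have lm : (l <= m)%N by lia.
(* The increasing cells are turned upside down, so that chains to the upper left become chains to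
   the lower left. The guard is needed because the truncated subtraction would send rows beyond [m]
   to row 0. *)
pose A i j := (j < m)%N && [exists t, c t i (m.-1 - j)%N].
pose B i j := [exists t, d t i j].
have Ak i j : (lchain A i j <= k)%N.
  apply: (@lchain_le_card _ _ (fun t i j => (j < m)%N && c t i (m.-1 - j)%N)).
    by move=> u v /andP[vm /existsP[t h]]; exists t; rewrite vm.
  move=> t u v u' v' /andP[vm h] /andP[v'm h'] uu vv.
  by apply: cP h h' uu _; lia.
have Bl i j : (lchain B i j <= l)%N.
  apply: (@lchain_le_card _ _ d _ dP) => u v /existsP[t h]; by exists t.
pose a i j : int := (cchain A m k i (m - j))%:Z.
pose b i j : int := (cchain B m l i j)%:Z.
have : (m * m)%:Z + \sum_(j < m) a m j * (b m j.+1 - b m j) <=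
    \sum_(j < m) (a m j + b m j.+1) + \sum_(i < m) (a i 0%N + b i m).
  apply: area_bound.
  - move=> i j im jm; rewrite /a.
    have -> : (m - j = (m - j.+1).+1)%N by lia.
    have := cchain_homoL A m k i (m - j.+1).
    have := cchain_homoL A m k i (m - j.+1).+1.
    have := cchain_homoR A m k i (m - j.+1).
    have := cchain_homoR A m k i.+1 (m - j.+1).
    have := @cchain_SS A m k i (m - j.+1) im.
    by split; lia.
  - move=> i j im jm; rewrite /b.
    have := cchain_homoL B m l i j.
    have := cchain_homoL B m l i j.+1.
    have := cchain_homoR B m l i j.
    have := cchain_homoR B m l i.+1 j.
    have := @cchain_SS B m l i j im.
    by split; lia.
  - move=> i j im jm; rewrite /a /b.
    have -> : (m - j = (m - j.+1).+1)%N by lia.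
    have := cchain_homoL A m k i (m - j.+1).
    have := cchain_homoR A m k i.+1 (m - j.+1).
    have := cchain_homoL B m l i j.
    have := cchain_homoR B m l i.+1 j.
    have [[t h]|[t h]] := cov i j im jm.
      have Aij : A i (m - j.+1)%N.
        rewrite /A; apply/andP; split; first lia.
        by apply/existsP; exists t; have -> : (m.-1 - (m - j.+1) = j)%N by lia.
      have := @cchain_lt A m k _ _ im Aij; lia.
    have Bij : B i j by apply/existsP; exists t.
    have := @cchain_lt B m l _ _ im Bij; lia.
  - by move=> j jm; have := cchain_le km (Ak _ (m - j)%N) (leq0n m); rewrite /a; lia.
  - by move=> i im; rewrite /a subnn cchain_0R.
  - by move=> j jm; have := cchain_le lm (Bl _ j) (leq0n m); rewrite /b; lia.
  - by move=> i im; rewrite /b cchain_0R.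
(* On the right side [b] grows only for j < l, and there k + l <= m makes [a] equal to k. *)
have -> : \sum_(j < m) a m j * (b m j.+1 - b m j) = k%:Z * l%:Z.
  pose f j : int := k%:Z * (minn l j)%:Z.
  transitivity (\sum_(j < m) (f j.+1 - f j)).
    apply: eq_bigr => j _; rewrite /a /b /f !cchain_last // -mulrBr.
    have [lj|jl] := leqP l j.
      have -> : minn l j.+1 = l by lia.
      by rewrite subrr !mulr0.
    by have -> : minn k (m - j) = k by lia.
  by rewrite sum_telescope /f minn0 mulr0 subr0 (minn_idPl lm).
have ma : \sum_(j < m) a m j = \sum_(j < m) (minn k j.+1)%:Z.
  rewrite (reindex_inj rev_ord_inj) /=; apply: eq_bigr => j _.
  rewrite /a cchain_last //; congr (minn k _)%:Z.
  by have := ltn_ord j; lia.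
have mb : \sum_(j < m) b m j.+1 = \sum_(j < m) (minn l j.+1)%:Z.
  by apply: eq_bigr => j _; rewrite /b cchain_last.
have a0 : \sum_(i < m) a i 0%N <= \sum_(i < m) (minn k i)%:Z.
  by apply: ler_sum => i _; have := cchain_le km (Ak _ (m - 0)%N) (ltnW (ltn_ord i)).
have bm : \sum_(i < m) b i m <= \sum_(i < m) (minn l i)%:Z.
  by apply: ler_sum => i _; have := cchain_le lm (Bl _ m) (ltnW (ltn_ord i)).
have := sum_minn km; have := sum_minn lm.
rewrite !big_split /= ma mb PoszM PoszD.
set s1 := (\sum_(j < m) _); set s2 := (\sum_(j < m) _).
set s3 := (\sum_(j < m) _); set s4 := (\sum_(j < m) _).
move=> e1 e2 h.
have : m%:Z * m%:Z + k%:Z * l%:Z <= k%:Z * (2 * m%:Z - k%:Z) + l%:Z * (2 * m%:Z - l%:Z).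
  by rewrite -e1 -e2 addrACA; apply: le_trans h _; rewrite lerD2l lerD.
by move=> h'; nra.
Qed.

(** * The lower bound for polyominoes in the plane *)

Lemma sorted_comparable (T : eqType) (e : rel T) (s : seq T) :
  transitive e -> sorted e s -> {in s &, forall x y, [|| x == y, e x y | e y x]}.
Proof.
move=> tr; rewrite sorted_pairwise //; elim: s => // z s IH /= /andP[/allP zs ss].
move=> x y; rewrite !inE => /predU1P[->|xs] /predU1P[->|ys].
- by rewrite eqxx.
- by rewrite zs ?orbT.
- by rewrite zs ?orbT.
- exact: IH.
Qed.

Lemma incr_antichain (s : seq (int * int)) : sorted incr_step s ->
  {in s &, forall c d, c.1 < d.1 -> d.2 < c.2 -> False}.
Proof.
pose e := [rel c d : int * int | (c.1 <= d.1) && (c.2 <= d.2)].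
have tr : transitive e by move=> y x z /=; lia.
have sub : subrel incr_step e by move=> x y /orP[] /eqP -> /=; lia.
move=> /(sub_sorted sub) /(sorted_comparable tr) H c d cs ds.
have /= := H c d cs ds; case/or3P => [/eqP ->||]; lia.
Qed.

Lemma decr_antichain (s : seq (int * int)) : sorted decr_step s ->
  {in s &, forall c d, c.1 < d.1 -> c.2 < d.2 -> False}.
Proof.
pose e := [rel c d : int * int | (c.1 <= d.1) && (d.2 <= c.2)].
have tr : transitive e by move=> y x z /=; lia.
have sub : subrel decr_step e by move=> x y /orP[] /eqP -> /=; lia.
move=> /(sub_sorted sub) /(sorted_comparable tr) H c d cs ds.
have /= := H c d cs ds; case/or3P => [/eqP ->||]; lia.
Qed.

(** Closed cells overlap along edges, but a centre lies in its own cell only; testing centres turns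
    a covering of points into one of cells. *)
Lemma cell_centre (R : realType) (c d : int * int) :
  cell R d (c.1%:~R - 2^-1, c.2%:~R - 2^-1) -> c = d.
Proof.
have h (x y : int) :
    y%:~R - 1 <= x%:~R - 2^-1 :> R -> x%:~R - 2^-1 <= y%:~R :> R -> x = y.
  move=> h1 h2.
  have : y%:~R < (x + 1)%:~R :> R by rewrite intrD mulr1z; lra.
  have : x%:~R < (y + 1)%:~R :> R by rewrite intrD mulr1z; lra.
  by rewrite !ltr_int; lia.
case: c d => [c1 c2] [d1 d2] [].
rewrite /= !in_itv /= => /andP[h1 h2] /andP[h3 h4].
by rewrite (h c1 d1) // (h c2 d2).
Qed.

Lemma coverable_ge (R : realType) (m p : nat) :
  coverable R m m p -> (2 * m <= 3 * p)%N.
Proof.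
move=> [F [Fm cov]]; have [mp|pm] := leqP m p; first lia.
(* Each polyomino gets a single tag, [true] for increasing, even if it is monotonous both ways; so
   the two classes partition the indices. *)
have /boolp.choice[f fP] (i : 'I_p) : exists bs : bool * seq (int * int),
    sorted (if bs.1 then incr_step else decr_step) bs.2 /\
    F i = (\bigcup_(c in [set` bs.2]) cell R c)%classic.
  by have [[] [s [_ ss e]] _] := Fm i; [exists (true, s)|exists (false, s)].
pose I := {i | (f i).1}; pose J := {i | ~~ (f i).1}.
have IJ : (#|{: I}| + #|{: J}| = p)%N.
  by rewrite !card_sig -[RHS]card_ord -(cardC [pred i | (f i).1]).
pose cellin (i : 'I_p) (x y : nat) := (x.+1%:Z, y.+1%:Z) \in (f i).2.
have := @grid_cover_area m {: I} {: J}
  (fun t => cellin (val t)) (fun t => cellin (val t)).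
rewrite IJ => /(_ _ _ _ (ltnW pm)) H.
have {}H : (m%:Z - p%:Z) ^+ 2 <= #|{: I}|%:Z * #|{: J}|%:Z.
  apply: H.
  - move=> [t ht] x y x' y' /= hc hd xx yy.
    have [st _] := fP t; rewrite ht in st.
    by apply: (incr_antichain st hc hd) => /=; lia.
  - move=> [t ht] x y x' y' /= hc hd xx yy.
    have [st _] := fP t; rewrite (negbTE ht) in st.
    by apply: (decr_antichain st hc hd) => /=; lia.
  move=> x y xm ym.
  pose z : R * R := ((x.+1%:Z)%:~R - 2^-1, (y.+1%:Z)%:~R - 2^-1).
  have : rectangle R m m z.
    rewrite /rectangle minnn; case: eqP => [?|_]; first lia.
    have h (u : nat) : (u < m)%N -> 0 <= u.+1%:R - 2^-1 :> R /\ u.+1%:R - 2^-1 <= m%:R :> R.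
      rewrite -(ler_nat R) -natr1 => um; have := ler0n R u; lra.
    by split; rewrite /= in_itv /= -pmulrn; apply/andP; apply: h.
  rewrite cov => -[i _]; have [_ ->] := fP i => -[c /= cs /(@cell_centre R (_, _)) e].
  rewrite -e in cs; case ti: (f i).1.
    by left; exists (exist _ i ti).
  by right; exists (exist _ i (negbT ti)).
have e : p%:Z = #|{: I}|%:Z + #|{: J}|%:Z by rewrite -PoszD IJ.
(* By 4xy <= (x + y)^2; as p < m, taking roots then gives 2 (m - p) <= p. *)
have h : 4 * (m%:Z - p%:Z) ^+ 2 <= p%:Z ^+ 2.
  have := sqr_ge0 (#|{: I}|%:Z - #|{: J}|%:Z).
  move: H; rewrite e; move: (_%:Z) (_%:Z) => x y H; nia.
nia.
Qed.

(** * Coverings described by lists of cells *)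

Definition square_cells (m : nat) : pred (int * int) :=
  fun c => (1 <= c.1 <= m%:Z) && (1 <= c.2 <= m%:Z).

Definition grid_covering (m : nat) (L : seq (seq (int * int))) : Prop :=
  all (fun s => (s != [::]) && (sorted incr_step s || sorted decr_step s)) L /\
  flatten L =i square_cells m.

Lemma cell_sub_rectangle (R : realType) (m : nat) (c : int * int) :
  square_cells m c -> (cell R c `<=` rectangle R m m)%classic.
Proof.
move=> /andP[/andP[h1 h2] /andP[h3 h4]] z [] /=; rewrite /rectangle minnn.
case: eqP => [?|_]; first by lia.
have h (u : int) : 1 <= u -> u <= m%:Z ->
    0 <= u%:~R - 1 :> R /\ u%:~R <= m%:R :> R.
  move=> u1 um; split; last by rewrite (_ : m%:R = m%:Z%:~R) // ler_int.
  by rewrite subr_ge0 (_ : 1 = 1%:~R :> R) // ler_int.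
have [? ?] := h _ h1 h2; have [? ?] := h _ h3 h4.
rewrite !in_itv /= => /andP[a1 a2] /andP[a3 a4].
by split; rewrite /= in_itv /=; apply/andP; split; lra.
Qed.

Lemma grid_covering_coverable (R : realType) (m : nat) (L : seq (seq (int * int))) :
  grid_covering m L -> coverable R m m (size L).
Proof.
move=> [/allP Lm LE].
exists (fun i => \bigcup_(c in [set` nth [::] L i]) cell R c)%classic.
have mem_L (i : 'I_(size L)) : nth [::] L i \in L by rewrite mem_nth.
have Fsub (i : 'I_(size L)) :
    (\bigcup_(c in [set` nth [::] L i]) cell R c `<=` rectangle R m m)%classic.
  move=> z [c /= cs]; apply: cell_sub_rectangle.
  have : c \in flatten L by apply/flattenP; exists (nth [::] L i).
  by rewrite LE.
split.
  move=> i; split=> //.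
  by have /andP[s0 /orP[]] := Lm _ (mem_L i); [left|right]; exists (nth [::] L i).
apply/seteqP; split=> z; last by case=> i _; apply: Fsub.
rewrite /rectangle minnn; case: eqP => // /eqP; rewrite -lt0n.
case: m LE {Lm Fsub} => // m LE _ [] /=; rewrite !in_itv /=.
move=> /unit_interval_exists[i /andP[i1 i2]] /unit_interval_exists[j /andP[j1 j2]].
pose c : int * int := (i.+1%:Z, j.+1%:Z).
have : c \in flatten L.
  by rewrite LE unfold_in /square_cells /=; have := ltn_ord i; have := ltn_ord j; lia.
case/flattenP => s sL cs; have sz : (index s L < size L)%N by rewrite index_mem.
exists (Ordinal sz) => //; exists c; first by rewrite /= nth_index.
by split; rewrite /= in_itv /= -pmulrn -natr1; apply/andP; split; lra.
Qed.

(** * Paths with two turns *)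

Section Zigzag.

Variables (f g : int * int -> int * int) (c : int * int) (n1 n2 n3 : nat).

Let c1 := iter n1 f c.
Let c2 := iter n2 g c1.

Definition zigzag : seq (int * int) :=
  c :: traject f (f c) n1 ++ traject g (g c1) n2 ++ traject f (f c2) n3.

Lemma zigzag_sorted (e : rel (int * int)) :
  subrel (frel f) e -> subrel (frel g) e -> sorted e zigzag.
Proof.
move=> fe ge; rewrite /= /c2 /c1 !cat_path !last_traject.
apply/and3P; split.
- exact/(sub_path fe)/fpath_traject.
- exact/(sub_path ge)/fpath_traject.
- exact/(sub_path fe)/fpath_traject.
Qed.

(** Each corner already ends the preceding arm, so repeating it at the start of the next one adds no
    cell and makes all three arms full segments. *)
Lemma mem_zigzag (d : int * int) : (d \in zigzag) =
  [|| d \in traject f c n1.+1, d \in traject g c1 n2.+1 | d \in traject f c2 n3.+1].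
Proof.
have mem_last h x n : iter n h x \in traject h x n.+1.
  by apply/trajectP; exists n.
have : (d == c1) ==> ((d == c) || (d \in traject f (f c) n1)).
  by apply/implyP => /eqP ->; rewrite -in_cons -trajectS mem_last.
have : (d == c2) ==> ((d == c1) || (d \in traject g (g c1) n2)).
  by apply/implyP => /eqP ->; rewrite -in_cons -trajectS mem_last.
rewrite /zigzag !trajectS !in_cons !mem_cat.
case: (d == c); case: (d == c1); case: (d == c2) => //=;
  case: (d \in traject f (f c) n1); case: (d \in traject g (g c1) n2) => //=.
Qed.

End Zigzag.

Arguments zigzag : simpl never.

Lemma iter_right (x y : int) n : iter n right_neighbour (x, y) = (x + n%:Z, y).
Proof. by elim: n => [|n IH] /=; rewrite ?IH; congr (_, _) => /=; lia. Qed.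

Lemma iter_upper (x y : int) n : iter n upper_neighbour (x, y) = (x, y + n%:Z).
Proof. by elim: n => [|n IH] /=; rewrite ?IH; congr (_, _) => /=; lia. Qed.

Lemma iter_lower (x y : int) n : iter n lower_neighbour (x, y) = (x, y - n%:Z).
Proof. by elim: n => [|n IH] /=; rewrite ?IH; congr (_, _) => /=; lia. Qed.

Lemma mem_traject_right (x y : int) n d :
  (d \in traject right_neighbour (x, y) n.+1) = (d.2 == y) && (x <= d.1 <= x + n%:Z).
Proof.
case: d => u v; apply/trajectP/idP => /= [[i ltin]|h].
  by rewrite iter_right => -[-> ->]; lia.
by exists `|u - x|%N; [|rewrite iter_right; congr (_, _)]; lia.
Qed.

Lemma mem_traject_upper (x y : int) n d :
  (d \in traject upper_neighbour (x, y) n.+1) = (d.1 == x) && (y <= d.2 <= y + n%:Z).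
Proof.
case: d => u v; apply/trajectP/idP => /= [[i ltin]|h].
  by rewrite iter_upper => -[-> ->]; lia.
by exists `|v - y|%N; [|rewrite iter_upper; congr (_, _)]; lia.
Qed.

Lemma mem_traject_lower (x y : int) n d :
  (d \in traject lower_neighbour (x, y) n.+1) = (d.1 == x) && (y - n%:Z <= d.2 <= y).
Proof.
case: d => u v; apply/trajectP/idP => /= [[i ltin]|h].
  by rewrite iter_lower => -[-> ->]; lia.
by exists `|y - v|%N; [|rewrite iter_lower; congr (_, _)]; lia.
Qed.

Lemma zigzag_right_upper_incr c n1 n2 n3 :
  sorted incr_step (zigzag right_neighbour upper_neighbour c n1 n2 n3).
Proof.
by apply: zigzag_sorted => x y /eqP <-; rewrite /incr_step eqxx ?orbT.
Qed.

Lemma zigzag_lower_right_decr c n1 n2 n3 :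
  sorted decr_step (zigzag lower_neighbour right_neighbour c n1 n2 n3).
Proof.
by apply: zigzag_sorted => x y /eqP <-; rewrite /decr_step eqxx ?orbT.
Qed.

(** * The coverings that attain the bound *)

(** The new path has no initial descent: it follows the new top row, then goes down the new right
    column. *)
Lemma grid_coveringS (m : nat) (L : seq (seq (int * int))) :
  grid_covering m L ->
  grid_covering m.+1
    (zigzag lower_neighbour right_neighbour (1, m.+1%:Z) 0 m m :: L).
Proof.
move=> [Lm LE]; split=> [|d].
  apply/andP; split=> //. by rewrite zigzag_lower_right_decr orbT.
rewrite -[flatten _]/(_ ++ flatten L) mem_cat LE mem_zigzag (iter_lower _ _ 0) iter_right.
rewrite !mem_traject_lower mem_traject_right.
by case: d => x y; rewrite [RHS]unfold_in unfold_in /square_cells /=; lia.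
Qed.

Definition incr_band (k r : nat) : seq (int * int) :=
  zigzag right_neighbour upper_neighbour (1, r%:Z) (2 * k - r) (2 * k) (k + r - 1).

(** The image of [incr_band k r] under the clockwise quarter turn (x, y) -> (y, 3k + 1 - x). *)
Definition decr_band (k r : nat) : seq (int * int) :=
  zigzag lower_neighbour right_neighbour (r%:Z, (3 * k)%:Z)
    (2 * k - r) (2 * k) (k + r - 1).

Lemma mem_incr_band (k r : nat) (x y : int) : (0 < r <= k)%N ->
  ((x, y) \in incr_band k r) =
  [|| (y == r%:Z) && (1 <= x <= 2 * k%:Z + 1 - r%:Z),
      (x == 2 * k%:Z + 1 - r%:Z) && (r%:Z <= y <= 2 * k%:Z + r%:Z)
    | (y == 2 * k%:Z + r%:Z) && (2 * k%:Z + 1 - r%:Z <= x <= 3 * k%:Z)].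
Proof.
move=> rk; rewrite mem_zigzag iter_right iter_upper !mem_traject_right.
by rewrite mem_traject_upper /=; lia.
Qed.

Lemma mem_decr_band (k r : nat) (x y : int) : (0 < r <= k)%N ->
  ((x, y) \in decr_band k r) =
  [|| (x == r%:Z) && (k%:Z + r%:Z <= y <= 3 * k%:Z),
      (y == k%:Z + r%:Z) && (r%:Z <= x <= 2 * k%:Z + r%:Z)
    | (x == 2 * k%:Z + r%:Z) && (1 <= y <= k%:Z + r%:Z)].
Proof.
move=> rk; rewrite mem_zigzag iter_lower iter_right !mem_traject_lower.
by rewrite mem_traject_right /=; lia.
Qed.

Lemma grid_covering_bands (k : nat) :
  grid_covering (3 * k) (map (incr_band k) (iota 1 k) ++ map (decr_band k) (iota 1 k)).
Proof.
split.
  rewrite all_cat !all_map; apply/andP; split; apply/allP => r _.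
    by apply/andP; split=> //; rewrite zigzag_right_upper_incr.
  by apply/andP; split=> //; rewrite zigzag_lower_right_decr orbT.
move=> [x y]; rewrite [RHS]unfold_in /square_cells /=; apply/flattenP/idP => [[s]|xy].
  rewrite mem_cat => /orP[] /mapP[r]; rewrite mem_iota => rk ->.
    by rewrite mem_incr_band; lia.
  by rewrite mem_decr_band; lia.
have incrP (r : nat) : (0 < r <= k)%N -> (x, y) \in incr_band k r ->
    exists2 s, s \in map (incr_band k) (iota 1 k) ++ map (decr_band k) (iota 1 k)
      & (x, y) \in s.
  move=> rk h; exists (incr_band k r) => //.
  by rewrite mem_cat map_f // mem_iota; lia.
have decrP (r : nat) : (0 < r <= k)%N -> (x, y) \in decr_band k r ->
    exists2 s, s \in map (incr_band k) (iota 1 k) ++ map (decr_band k) (iota 1 k)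
      & (x, y) \in s.
  move=> rk h; exists (decr_band k r) => //.
  by rewrite mem_cat orbC map_f // mem_iota; lia.
case: x y xy incrP decrP => [x|x] [y|y] xy incrP decrP; try lia.
(* Cases by horizontal thirds. In the bottom third the cell is on the first or the vertical arm of
   an increasing band, or on the last arm of a decreasing one. The middle third uses only decreasing
   bands, and the top third mirrors the bottom one by a half turn. *)
have [yk|ky] := leqP y k.
  have [xy1|xy1] := leqP (x + y) (2 * k + 1).
    by apply: (incrP y); rewrite ?mem_incr_band; lia.
  have [xk|kx] := leqP x (2 * k).
    by apply: (incrP (2 * k + 1 - x)%N); rewrite ?mem_incr_band; lia.
  by apply: (decrP (x - 2 * k)%N); rewrite ?mem_decr_band; lia.
have [y2k|ky2] := leqP y (2 * k).
  have [xr|rx] := ltnP x (y - k).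
    by apply: (decrP x); rewrite ?mem_decr_band; lia.
  have [xr2|rx2] := leqP x (k + y).
    by apply: (decrP (y - k)%N); rewrite ?mem_decr_band; lia.
  by apply: (decrP (x - 2 * k)%N); rewrite ?mem_decr_band; lia.
have [xr|rx] := leqP (4 * k + 1) (x + y).
  by apply: (incrP (y - 2 * k)%N); rewrite ?mem_incr_band; lia.
have [xk|kx] := leqP x k.
  by apply: (decrP x); rewrite ?mem_decr_band; lia.
by apply: (incrP (2 * k + 1 - x)%N); rewrite ?mem_incr_band; lia.
Qed.

(** * The exact value *)

Theorem corollary3 (R : realType) (m : nat) :
  (cover_number R m m)%:Z = Num.ceil (2%:R / 3%:R * m%:R : R).
Proof.
rewrite /cover_number; case: ex_minnP => q /asboolP cov min.
have lo := coverable_ge cov.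
have hi : (q <= 2 * (m %/ 3) + m %% 3)%N.
  have [L gL <-] : exists2 L, grid_covering m L & size L = (2 * (m %/ 3) + m %% 3)%N.
    rewrite {1}(divn_eq m 3) mulnC; elim: (m %% 3)%N => [|r [L gL sL]].
      rewrite addn0; eexists; first exact: grid_covering_bands.
      by rewrite size_cat !size_map size_iota; lia.
    by rewrite !addnS; eexists; [exact: grid_coveringS gL|rewrite /= sL].
  by apply: min; apply/asboolP; apply: grid_covering_coverable.
(* With m = 3k + r and r <= 2, three times 2k + r is 2m + r. Since 2m + 2 < 2m + 3, this yields the
   strict bound q - 1 < 2m/3. *)
have {}hi : (3 * q <= 2 * m + 2)%N by lia.
apply/esym/ceil_def; rewrite intrB -!pmulrn.
move: lo hi; rewrite -!(ler_nat R) natrD !natrM => lo hi.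
by apply/andP; split; lra.
Qed.
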